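(* Let $A\in\mathbb{R}^{m\times n}$ and $0\neq b\in\mathbb{R}^m$, and consider the first $k\ge 1$ steps of the Golub-Kahan iterative bidiagonalization of $A$ started with $b$, where it is assumed that the process does not terminate before iteration $k+1$, i.e. $\alpha_l>0$ and $\beta_{l+1}>0$ for $l=1,\dots,k$. Let $r_k^{\text{LSQR}}=b-Ax_k^{\text{LSQR}}$, where $x_k^{\text{LSQR}}=W_k y_k^{\text{LSQR}}$ and $$y_k^{\text{LSQR}}=\operatorname{argmin}_{y\in\mathbb{R}^k}\|\beta_1e_1-L_{k+}y\|.$$ Then $$r_k^{\text{LSQR}}=\frac{1}{\sum_{l=0}^k\varphi_l(0)^2}\sum_{l=0}^k\varphi_l(0)\,s_{l+1}.$$ Consequently, $$\|r_k^{\text{LSQR}}\|=\frac{1}{\sqrt{\sum_{l=0}^k\varphi_l(0)^2}}.$$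
   Context: Exact arithmetic is assumed. $\|\cdot\|$ is the Euclidean norm and $e_j$ is the $j$-th column of an identity matrix of appropriate size. Golub-Kahan iterative bidiagonalization: put $w_0=0$, $\beta_1=\|b\|$, $s_1=b/\beta_1$, and for $j=1,2,\dots$ $$\alpha_j w_j = A^Ts_j-\beta_j w_{j-1},\quad \|w_j\|=1,\qquad \beta_{j+1}s_{j+1}=Aw_j-\alpha_j s_j,\quad \|s_{j+1}\|=1,$$ with $\alpha_j,\beta_{j+1}\ge 0$; the process stops when $\alpha_j=0$ or $\beta_{j+1}=0$, or $j=\min(m,n)$. The vectors $s_1,s_2,\dots$ are orthonormal, as are $w_1,w_2,\dots$. $W_k=[w_1,\dots,w_k]\in\mathbb{R}^{n\times k}$. $L_k\in\mathbb{R}^{k\times k}$ is the lower bidiagonal matrix with diagonal entries $\alpha_1,\dots,\alpha_k$ and subdiagonal entries $\beta_2,\dots,\beta_k$ (so $(L_k)_{j,j}=\alpha_j$, $(L_k)_{j+1,j}=\beta_{j+1}$), and $L_{k+}\in\mathbb{R}^{(k+1)\times k}$ is $L_k$ with the additional last row $\beta_{k+1}e_k^T$. For $l\ge 0$, $\varphi_l$ denotes the (Lanczos) polynomial of degree at most $l$ such that $s_{l+1}=\varphi_l(AA^T)b$; its constant term (the amplification factor) is $$\varphi_l(0)=(-1)^l\frac{1}{\beta_{l+1}}\prod_{j=1}^l\frac{\alpha_j}{\beta_j}$$ (so $\varphi_0(0)=1/\beta_1$). *)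

(* Defs.v *)
From mathcomp Require Import all_boot all_order all_algebra.

Set Implicit Arguments.
Unset Strict Implicit.
Unset Printing Implicit Defensive.

Import Order.TTheory GRing.Theory Num.Theory.
Local Open Scope ring_scope.

(* Sequences and unit vectors keep the customary 1-based indices; the values  *)
(* alpha 0, beta 0 and s 0 are never used.                                    *)

(* The norm on matrices provided by MathComp-Analysis is the sup norm, hence  *)
(* this definition.                                                           *)
Definition enorm (R : rcfType) (p : nat) (v : 'cV[R]_p) : R :=
  Num.sqrt (\sum_(i < p) v i 0 ^+ 2).

Definition unit_vec (R : rcfType) (p j : nat) : 'cV[R]_p :=
  \col_(i < p) (i.+1 == j)%:R.

(* Given as a relation rather than as a program: the unit vectors w j and     *)
(* s j.+1 are pinned down by these equations as long as alpha j and beta j.+1 *)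
(* are nonzero.                                                               *)
Record golub_kahan (R : rcfType) (m n : nat) (A : 'M[R]_(m, n)) (b : 'cV[R]_m)
    (k : nat) (alpha beta : nat -> R)
    (w : nat -> 'cV[R]_n) (s : nat -> 'cV[R]_m) : Prop := GolubKahan {
  gk_w0 : w 0%N = 0;
  gk_beta1 : beta 1%N = enorm b;
  gk_s1 : s 1%N = (beta 1%N)^-1 *: b;
  gk_alpha_ge0 : forall j, (1 <= j <= k)%N -> 0 <= alpha j;
  gk_w : forall j, (1 <= j <= k)%N ->
    alpha j *: w j = A^T *m s j - beta j *: w j.-1;
  gk_w_norm : forall j, (1 <= j <= k)%N -> enorm (w j) = 1;
  gk_beta_ge0 : forall j, (1 <= j <= k)%N -> 0 <= beta j.+1;
  gk_s : forall j, (1 <= j <= k)%N ->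
    beta j.+1 *: s j.+1 = A *m w j - alpha j *: s j;
  gk_s_norm : forall j, (1 <= j <= k)%N -> enorm (s j.+1) = 1
}.

Definition W_mx (R : rcfType) (n k : nat) (w : nat -> 'cV[R]_n) : 'M[R]_(n, k) :=
  \matrix_(i < n, j < k) w j.+1 i 0.

Definition L_mx (R : rcfType) (k : nat) (alpha beta : nat -> R) : 'M[R]_k :=
  \matrix_(i < k, j < k)
    if i == j :> nat then alpha j.+1
    else if i == j.+1 :> nat then beta j.+2 else 0.

Definition Lplus_mx (R : rcfType) (k : nat) (alpha beta : nat -> R) :
    'M[R]_(k + 1, k) :=
  col_mx (L_mx k alpha beta) (beta k.+1 *: (unit_vec R k k)^T).

(* The number of rows is a successor because horner_mx requires it. The two   *)
(* conditions determine phi l uniquely when s 1, ..., s k.+1 are produced by  *)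
(* a Golub-Kahan process with alpha j and beta j.+1 nonzero for 1 <= j <= k.  *)
Definition lanczos_polys (R : rcfType) (m n : nat) (A : 'M[R]_(m.+1, n))
    (b : 'cV[R]_m.+1) (k : nat) (s : nat -> 'cV[R]_m.+1)
    (phi : nat -> {poly R}) : Prop :=
  forall l, (l <= k)%N ->
    (size (phi l) <= l.+1)%N /\ s l.+1 = horner_mx (A *m A^T) (phi l) *m b.

Definition is_argmin (R : rcfType) (T : Type) (f : T -> R) (y : T) : Prop :=
  forall z : T, f y <= f z.

(* Main.v *)
Require Import Defs.
From mathcomp Require Import all_boot all_order all_algebra.

Import Order.TTheory GRing.Theory Num.Theory.
Local Open Scope ring_scope.

(** Both sequences of vectors are orthonormal, so the residual of the problem
    projected onto the Krylov space and the true residual are related by an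
    isometry: since A W_k = S_(k+1) L_(k+) and b = beta_1 s_1, one has
    r = S_(k+1) t with t = beta_1 e_1 - L_(k+) y ([gk_mulmx_W]).

    The matrix L_(k+) has k columns in dimension k + 1 and is bidiagonal, so the
    orthogonal complement of its range is a line: a vector f is orthogonal to
    the columns exactly when alpha_j f_(j-1) + beta_(j+1) f_j = 0 for 1 <= j <= k
    ([dot_col_Lplus], coordinates counted from 0), and such an f is determined
    by its first coordinate. The vector v with coordinates phi_l(0) lies on that
    line: this is the Lanczos recurrence evaluated at 0, where the term carrying
    the factor 'X vanishes ([lanczos_rec_horner0]). The least-squares residual t
    lies on it too, by the normal equations ([argmin_normal]). Hence t = c v, and
    c is found by pairing with v, which kills the range of L_(k+):
    c |v|^2 = <v, t> = beta_1 v_0 = 1. So t = v / |v|^2 ([lsq_residual]), and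
    applying the isometry S_(k+1) gives both the formula for r and its norm.

    The polynomials phi_l are only given by their degree bounds and their values
    s_(l+1) = phi_l(A A^T) b. They coincide with those produced by the recurrence
    because the latter form a graded basis of the polynomials and their values
    are orthonormal, hence linearly independent ([lanczos_polys_unique]). *)

(** * Euclidean inner product and orthonormal sequences *)

Section InnerProduct.
Set Implicit Arguments.
Unset Strict Implicit.
Unset Printing Implicit Defensive.
Variable R : rcfType.

Definition dot (p : nat) (u v : 'cV[R]_p) : R := (u^T *m v) 0 0.

Lemma dotE p (u v : 'cV[R]_p) : dot u v = \sum_i u i 0 * v i 0.
Proof. by rewrite /dot mxE; apply: eq_bigr => i _; rewrite mxE. Qed.

Lemma dotC p (u v : 'cV[R]_p) : dot u v = dot v u.
Proof. by rewrite !dotE; apply: eq_bigr => i _; rewrite mulrC. Qed.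

Lemma dotDr p (u v v' : 'cV[R]_p) : dot u (v + v') = dot u v + dot u v'.
Proof. by rewrite /dot mulmxDr mxE. Qed.

Lemma dotZr p a (u v : 'cV[R]_p) : dot u (a *: v) = a * dot u v.
Proof. by rewrite /dot -scalemxAr mxE. Qed.

Lemma dotBr p (u v v' : 'cV[R]_p) : dot u (v - v') = dot u v - dot u v'.
Proof. by rewrite dotDr -scaleN1r dotZr mulN1r. Qed.

Lemma dot0r p (u : 'cV[R]_p) : dot u 0 = 0.
Proof. by rewrite /dot mulmx0 mxE. Qed.

Lemma dot_sumr p (u : 'cV[R]_p) I (r : seq I) (P : pred I) (F : I -> 'cV[R]_p) :
  dot u (\sum_(i <- r | P i) F i) = \sum_(i <- r | P i) dot u (F i).
Proof. by rewrite /dot mulmx_sumr summxE. Qed.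

Lemma dot_trmx p q (A : 'M[R]_(p, q)) u v : dot u (A^T *m v) = dot (A *m u) v.
Proof. by rewrite /dot trmx_mul mulmxA. Qed.

Lemma dot_eq0 p (u : 'cV[R]_p) : dot u u = 0 -> u = 0.
Proof.
rewrite dotE => /eqP; rewrite psumr_eq0 => [/allP u0|i _]; last exact: sqr_ge0.
apply/colP => i; have /u0 := mem_index_enum i.
by rewrite mulf_eq0 orbb mxE => /eqP.
Qed.

Lemma enormE p (u : 'cV[R]_p) : enorm u = Num.sqrt (dot u u).
Proof. by rewrite dotE. Qed.

Lemma dot_ge0 p (u : 'cV[R]_p) : 0 <= dot u u.
Proof. by rewrite dotE sumr_ge0 // => i _; rewrite sqr_ge0. Qed.

Lemma enorm1_dot p (u : 'cV[R]_p) : enorm u = 1 -> dot u u = 1.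
Proof. by rewrite enormE => u1; rewrite -(sqr_sqrtr (dot_ge0 u)) u1 expr1n. Qed.

Lemma enorm_eq0 p (u : 'cV[R]_p) : enorm u = 0 -> u = 0.
Proof.
rewrite enormE => u0; apply: dot_eq0.
by rewrite -(sqr_sqrtr (dot_ge0 u)) u0 expr0n.
Qed.

(** The best step along [u] from [t], of length <t, u> / <u, u>, lowers the
    squared norm by <t, u>^2 / <u, u>; it cannot lower it, so <t, u> = 0. *)
Lemma dot_eq0_of_min p (t u : 'cV[R]_p) :
  (forall c, enorm t <= enorm (t - c *: u)) -> dot t u = 0.
Proof.
move=> tmin; have [uu0|uu0] := eqVneq (dot u u) 0.
  by rewrite (dot_eq0 uu0) dot0r.
pose c := dot t u / dot u u.
have tcE : dot (t - c *: u) (t - c *: u) = dot t t - c * dot t u.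
  rewrite dotBr dotZr (dotC _ t) (dotC _ u) !dotBr !dotZr (dotC u t).
  by rewrite (divfK uu0) subrr mulr0 subr0.
have := tmin c; rewrite !enormE ler_sqrt ?dot_ge0 // tcE.
rewrite -subr_le0 opprB addrCA subrr addr0 mulrAC -expr2.
rewrite pmulr_lle0 ?invr_gt0 ?lt_def ?uu0 ?dot_ge0 //.
by rewrite real_exprn_even_le0 ?num_real //= => /eqP.
Qed.

(** Indices start at 1, as in the bidiagonalization; [v 0] is unconstrained
    (there [w 0] is the zero vector). *)
Definition orthonormal_upto p (v : nat -> 'cV[R]_p) (j : nat) :=
  forall i l, (0 < i <= j)%N -> (0 < l <= j)%N -> dot (v i) (v l) = (i == l)%:R.

Lemma orthonormal_upto0 p (v : nat -> 'cV[R]_p) : orthonormal_upto v 0.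
Proof. by move=> i l /andP[i0]; rewrite leqn0 => /eqP i0'; rewrite i0' in i0. Qed.

Lemma orthonormal_uptoS p (v : nat -> 'cV[R]_p) j :
    orthonormal_upto v j -> dot (v j.+1) (v j.+1) = 1 ->
    (forall i, (0 < i <= j)%N -> dot (v i) (v j.+1) = 0) ->
  orthonormal_upto v j.+1.
Proof.
move=> vj v1 v0 i l /andP[i0 ij] /andP[l0 lj].
move: ij lj; rewrite (leq_eqVlt i) (leq_eqVlt l) !ltnS.
case/predU1P => [->|ij]; case/predU1P => [->|lj].
- by rewrite eqxx.
- by rewrite dotC v0 ?l0 // gtn_eqF.
- by rewrite v0 ?i0 // ltn_eqF.
- by apply: vj; rewrite ?i0 ?l0.
Qed.

Lemma orthonormal_comb p (v : nat -> 'cV[R]_p) j (c : nat -> R) i :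
    orthonormal_upto v j.+1 -> (i <= j)%N ->
  dot (v i.+1) (\sum_(l < j.+1) c l *: v l.+1) = c i.
Proof.
move=> vj ij; rewrite dot_sumr (bigD1 (Ordinal (ij : i < j.+1)%N)) //=.
rewrite dotZr vj ?ltnS // eqxx mulr1 big1 ?addr0 // => l.
rewrite -val_eqE /= => li; rewrite dotZr vj ?ltn_ord //.
by rewrite eqSS eq_sym (negPf li) mulr0.
Qed.

Lemma dot_orthonormal_comb p (v : nat -> 'cV[R]_p) j (c : nat -> R) :
    orthonormal_upto v j.+1 ->
  dot (\sum_(l < j.+1) c l *: v l.+1) (\sum_(l < j.+1) c l *: v l.+1) =
  \sum_(l < j.+1) c l ^+ 2.
Proof.
move=> vj; rewrite [LHS]dot_sumr; apply: eq_bigr => l _.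
by rewrite dotZr dotC orthonormal_comb // -ltnS.
Qed.

End InnerProduct.

(** * Graded bases of polynomials *)

Section GradedBasis.
Set Implicit Arguments.
Unset Strict Implicit.
Unset Printing Implicit Defensive.

(** Subtracting the multiple of [psi d] with the same coefficient of degree [d]
    lowers the degree, as in a division algorithm. *)
Lemma graded_span (F : fieldType) (k : nat) (psi : nat -> {poly F}) :
    (forall i, (i <= k)%N -> size (psi i) = i.+1) ->
  forall d (p : {poly F}), (d <= k.+1)%N -> (size p <= d)%N ->
  exists c : nat -> F, p = \sum_(i < d) c i *: psi i.
Proof.
move=> szpsi d p; elim: d p => [|d IHd] p dk szp.
  move: szp; rewrite size_poly_leq0 => /eqP ->; exists (fun=> 0).
  by rewrite big_ord0.
have lc0 : (psi d)`_d != 0.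
  have <- : lead_coef (psi d) = (psi d)`_d by rewrite lead_coefE szpsi.
  by rewrite lead_coef_eq0 -size_poly_eq0 szpsi.
pose a := p`_d / (psi d)`_d.
have [|c def_p] := IHd (p - a *: psi d) (ltnW dk).
  apply/leq_sizeP => i; rewrite leq_eqVlt coefB coefZ => /predU1P[<-|di].
    by rewrite divfK // subrr.
  by rewrite !nth_default ?mulr0 ?subrr ?szpsi // (leq_trans szp).
exists (fun i => if i == d then a else c i).
rewrite big_ord_recr /= eqxx -[LHS](subrK (a *: psi d)) def_p; congr (_ + _).
by apply: eq_bigr => i _; rewrite ltn_eqF.
Qed.

End GradedBasis.

(** * The bidiagonalization and its polynomials *)

Section Process.
Set Implicit Arguments.
Unset Strict Implicit.
Unset Printing Implicit Defensive.
Variables (R : rcfType) (m n k : nat) (A : 'M[R]_(m.+1, n)) (b : 'cV[R]_m.+1).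
Variables (alpha beta : nat -> R) (w : nat -> 'cV[R]_n) (s : nat -> 'cV[R]_m.+1).
Hypothesis b0 : b != 0.
Hypothesis gk : golub_kahan A b k alpha beta w s.
Hypothesis pos : forall l, (1 <= l <= k)%N -> 0 < alpha l /\ 0 < beta l.+1.

Lemma alpha_neq0 j : (0 < j <= k)%N -> alpha j != 0.
Proof. by case/pos => /lt0r_neq0. Qed.

Lemma beta1_neq0 : beta 1 != 0.
Proof.
by rewrite (gk_beta1 gk); apply: contraNneq b0 => /enorm_eq0 ->.
Qed.

Lemma beta_neq0 j : (j <= k)%N -> beta j.+1 != 0.
Proof.
case: j => [_|j jk]; first exact: beta1_neq0.
by have [] := pos (l := j.+1) jk => _ /lt0r_neq0.
Qed.

Lemma gk_mulA j : (0 < j <= k)%N ->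
  A *m w j = alpha j *: s j + beta j.+1 *: s j.+1.
Proof. by move=> jk; rewrite (gk_s gk jk) addrC subrK. Qed.

Lemma gk_mulAT j : (0 < j <= k)%N ->
  A^T *m s j = alpha j *: w j + beta j *: w j.-1.
Proof. by move=> jk; rewrite (gk_w gk jk) subrK. Qed.

Lemma dot_s1 : dot (s 1) (s 1) = 1.
Proof.
rewrite (gk_s1 gk) dotZr dotC dotZr.
rewrite -[dot b b](sqr_sqrtr (dot_ge0 b)) -enormE -(gk_beta1 gk).
by rewrite expr2 !mulKf ?mulVf ?beta1_neq0.
Qed.

(** Each new vector is obtained from the adjoint of the operator that produced
    the other family, so pairing it with an older vector moves the operator onto
    that older vector, where it only yields two neighbouring vectors of the other
    family. By orthonormality of that family a single term may survive, and it is
    cancelled by the subtracted multiple of the previous vector. The two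
    families have to be treated in one induction. *)
Lemma golub_kahan_orthonormal j : (j <= k)%N ->
  orthonormal_upto s j.+1 /\ orthonormal_upto w j.
Proof.
elim: j => [_|j IHj jk].
  split; last exact: orthonormal_upto0.
  apply: orthonormal_uptoS; [exact: orthonormal_upto0|exact: dot_s1|].
  by move=> i /andP[i0]; rewrite leqNgt i0.
have [so wo] := IHj (ltnW jk).
(* <w_i, w_(j+1)> is, up to alpha_(j+1), <A w_i, s_(j+1)> - beta_(j+1) <w_i, w_j>,
   where A w_i = alpha_i s_i + beta_(i+1) s_(i+1). *)
have wo' : orthonormal_upto w j.+1.
  apply: orthonormal_uptoS => // [|i ij].
    by apply: enorm1_dot; rewrite (gk_w_norm gk).
  have /andP[i0 ij'] := ij.
  apply: (mulfI (alpha_neq0 (j := j.+1) jk)).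
  rewrite -dotZr (gk_w gk) // dotBr dot_trmx gk_mulA; last first.
    by rewrite i0 (leq_trans ij') // ltnW.
  rewrite dotC dotDr !dotZr /= wo ?leqnn ?andbT ?(leq_trans i0 ij') //.
  rewrite !so ?leqnn ?ltnS ?i0 ?(leqW ij') //= (gtn_eqF (ij' : i < j.+1)%N).
  rewrite mulr0 add0r mulr0.
  rewrite eqSS eq_sym; case: eqP => [->|_]; last by rewrite !mulr0 subrr.
  by rewrite subrr.
(* <s_i, s_(j+2)> is, up to beta_(j+2),
   <A^T s_i, w_(j+1)> - alpha_(j+1) <s_i, s_(j+1)>,
   where A^T s_i = alpha_i w_i + beta_i w_(i-1). *)
split=> //; apply: orthonormal_uptoS => // [|i ij].
  by apply: enorm1_dot; rewrite (gk_s_norm gk).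
have /andP[i0 ij'] := ij.
apply: (mulfI (beta_neq0 (j := j.+1) jk)).
rewrite -dotZr (gk_s gk) // dotBr -[A]trmxK dot_trmx gk_mulAT; last first.
  by rewrite i0 (leq_trans ij').
rewrite dotC dotDr !dotZr wo' // ?ltnS ?leqnn // so ?ltnS ?leqnn //.
have -> : dot (w j.+1) (w i.-1) = 0.
  case: i i0 ij ij' => // [[|i]] _ _ /= ij'; first by rewrite (gk_w0 gk) dot0r.
  by rewrite wo' ?leqnn ?(ltnW ij') ?(gtn_eqF ij').
rewrite !mulr0 addr0 eq_sym; case: eqP => [->|_]; last by rewrite !mulr0 subrr.
by rewrite subrr.
Qed.

(** The process with vectors replaced by polynomials in A A^T applied to [b]:
    the pair (psi_j, omega_j) represents s_(j+1) and w_j through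
    s_(j+1) = psi_j(A A^T) b and w_j = A^T omega_j(A A^T) b, so that
    multiplication by A turns omega_j into 'X * omega_j. *)
Fixpoint lanczos_rec (j : nat) : {poly R} * {poly R} :=
  if j is i.+1 then
    let: (psi, omega) := lanczos_rec i in
    let omega' := (alpha i.+1)^-1 *: (psi - beta i.+1 *: omega) in
    ((beta i.+2)^-1 *: ('X * omega' - alpha i.+1 *: psi), omega')
  else ((beta 1)^-1%:P, 0).

Definition krylov (p : {poly R}) : 'cV[R]_m.+1 := horner_mx (A *m A^T) p *m b.

Lemma krylovB p q : krylov (p - q) = krylov p - krylov q.
Proof. by rewrite /krylov rmorphB mulmxBl. Qed.

Lemma krylovZ c p : krylov (c *: p) = c *: krylov p.
Proof. by rewrite /krylov linearZ /= -scalemxAl. Qed.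

Lemma krylovMX p : krylov ('X * p) = A *m (A^T *m krylov p).
Proof. by rewrite /krylov rmorphM /= horner_mx_X -mulmxE !mulmxA. Qed.

Lemma krylov_sum (I : finType) (F : I -> {poly R}) :
  krylov (\sum_i F i) = \sum_i krylov (F i).
Proof. by rewrite /krylov rmorph_sum mulmx_suml. Qed.

Lemma lanczos_recP j : (j <= k)%N ->
  [/\ size (lanczos_rec j).1 = j.+1, size (lanczos_rec j).2 = j,
      s j.+1 = krylov (lanczos_rec j).1 &
      w j = A^T *m krylov (lanczos_rec j).2].
Proof.
elim: j => [_|j IHj jk] /=.
  rewrite size_polyC invr_eq0 beta1_neq0 size_poly0; split=> //.
    by rewrite /krylov horner_mx_C mul_scalar_mx (gk_s1 gk).
  by rewrite (gk_w0 gk) /krylov rmorph0 mul0mx mulmx0.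
have [] := IHj (ltnW jk); case: (lanczos_rec j) => psi omega /=.
move=> szpsi szomega def_s def_w.
set omega' := _ *: (psi - _).
have szomega' : size omega' = j.+1.
  rewrite size_scale ?invr_eq0 ?alpha_neq0 // size_polyDl ?szpsi // size_polyN.
  by rewrite ltnS -{2}szomega size_scale_leq.
have def_w' : w j.+1 = A^T *m krylov omega'.
  apply: (scalerI (alpha_neq0 (j := j.+1) jk)); rewrite (gk_w gk) //.
  rewrite krylovZ -scalemxAr scalerA divff ?alpha_neq0 // scale1r.
  by rewrite krylovB krylovZ mulmxBr -scalemxAr -def_s -def_w.
split=> //.
  rewrite size_scale ?invr_eq0 ?beta_neq0 // size_polyDl.
    by rewrite mulrC size_mulX -?size_poly_eq0 ?szomega'.
  rewrite size_polyN mulrC size_mulX -?size_poly_eq0 szomega' // ltnS -szpsi.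
  exact: size_scale_leq.
apply: (scalerI (beta_neq0 (j := j.+1) jk)); rewrite (gk_s gk) //.
rewrite krylovZ scalerA divff ?beta_neq0 // scale1r.
by rewrite krylovB krylovMX -def_w' krylovZ -def_s.
Qed.

Lemma lanczos_rec_horner0 j : (j < k)%N ->
  alpha j.+1 * (lanczos_rec j).1.[0] + beta j.+2 * (lanczos_rec j.+1).1.[0] = 0.
Proof.
move=> jk; rewrite /=; case: (lanczos_rec j) => psi omega /=.
rewrite hornerZ mulVKf ?(beta_neq0 (j := j.+1)) //.
by rewrite hornerD hornerM hornerX mul0r add0r hornerN hornerZ subrr.
Qed.

(** Expand [phi l] in the graded basis given by the recurrence; applying both
    sides to [b] expresses s_(l+1) in the orthonormal vectors s_1, ..., s_(l+1),
    so the coefficients are those of a unit vector. *)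
Lemma lanczos_polys_unique phi l :
  lanczos_polys A b k s phi -> (l <= k)%N -> phi l = (lanczos_rec l).1.
Proof.
move=> phiP lk; have [szphi def_s] := phiP l lk.
have szpsi i : (i <= k)%N -> size (lanczos_rec i).1 = i.+1 by case/lanczos_recP.
have [c def_phi] := graded_span szpsi (lk : l.+1 <= k.+1)%N szphi.
have {}def_s : s l.+1 = \sum_(i < l.+1) c i *: s i.+1.
  rewrite def_s -/(krylov _) def_phi krylov_sum; apply: eq_bigr => i _.
  have [|_ _ -> _] := @lanczos_recP i; first by rewrite (leq_trans _ lk) // -ltnS.
  by rewrite krylovZ.
have [so _] := golub_kahan_orthonormal lk.
have c_delta i : (i <= l)%N -> c i = (i == l)%:R.
  by move=> il; rewrite -(orthonormal_comb c so il) -def_s so ?eqSS ?ltnS ?leqnn.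
rewrite def_phi big_ord_recr /= big1 => [|i _].
  by rewrite c_delta // eqxx scale1r add0r.
by rewrite c_delta ?ltn_eqF ?scale0r // ltnW.
Qed.

End Process.

(** * The projected least-squares problem *)

Section ProjectedProblem.
Set Implicit Arguments.
Unset Strict Implicit.
Unset Printing Implicit Defensive.
Variable R : rcfType.

(** Recurrences on coordinates are simpler with indices in [nat] than with
    ordinals bounded by [k + 1]. *)
Lemma col_of_nat p (v : 'cV[R]_p) : exists t : nat -> R, v = \col_(i < p) t i.
Proof.
exists (fun i => if insub i is Some i' then v i' 0 else 0).
by apply/colP => i; rewrite mxE valK.
Qed.

Lemma sum_ord_delta p (f : nat -> R) j : (j < p)%N ->
  \sum_(i < p) f i * (i == j :> nat)%:R = f j.
Proof.
move=> jp; rewrite (bigD1 (Ordinal jp)) //= eqxx mulr1 big1 ?addr0 // => i.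
by rewrite -val_eqE /= => /negPf ->; rewrite mulr0.
Qed.

Lemma dot_mulmx p q (v : 'cV[R]_p) (M : 'M[R]_(p, q)) (y : 'cV[R]_q) :
  dot v (M *m y) = \sum_j y j 0 * dot v (col j M).
Proof.
rewrite -[M]trmxK dot_trmx dotE; apply: eq_bigr => j _.
rewrite mulrC mxE dotE; congr (_ * _); apply: eq_bigr => i _.
by rewrite !mxE mulrC.
Qed.

Lemma W_mx_mul p q (v : nat -> 'cV[R]_p) (t : nat -> R) :
  W_mx q v *m (\col_(i < q) t i) = \sum_(i < q) t i *: v i.+1.
Proof.
apply/colP => i; rewrite mxE summxE; apply: eq_bigr => j _.
by rewrite !mxE mulrC.
Qed.

Variables (k : nat) (alpha beta : nat -> R).

Lemma Lplus_mxE (i : 'I_(k + 1)) (j : 'I_k) :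
  Lplus_mx k alpha beta i j =
  alpha j.+1 * (i == j :> nat)%:R + beta j.+2 * (i == j.+1 :> nat)%:R.
Proof.
rewrite mxE; case: splitP => [i' ->|i' ->]; rewrite !mxE.
  case: eqP => [->|_]; first by rewrite (ltn_eqF (ltnSn _)) mulr1 mulr0 addr0.
  by case: eqP => _; rewrite mulr0 add0r ?mulr1 ?mulr0.
rewrite ord1 addn0 (gtn_eqF (ltn_ord j)) mulr0 add0r eq_sym.
by case: eqP => [e|_]; rewrite ?mulr0 -?e.
Qed.

Lemma sum_Lplus_mx (f : nat -> R) (j : 'I_k) :
  \sum_(i < k + 1) f i * Lplus_mx k alpha beta i j =
  alpha j.+1 * f j + beta j.+2 * f j.+1.
Proof.
under eq_bigr do rewrite Lplus_mxE mulrDr !(mulrCA (f _)).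
have jk : (j.+1 < k + 1)%N by rewrite addn1 ltnS.
by rewrite big_split /= -!mulr_sumr !sum_ord_delta ?jk ?(ltnW jk).
Qed.

Lemma dot_col_Lplus (f : nat -> R) (j : 'I_k) :
  dot (\col_(i < k + 1) f i) (col j (Lplus_mx k alpha beta)) =
  alpha j.+1 * f j + beta j.+2 * f j.+1.
Proof. by rewrite dotE -sum_Lplus_mx; apply: eq_bigr => i _; rewrite !mxE. Qed.

(** The normal equations, one column at a time: a step along the unit vector
    number [j] moves the residual along column [j]. *)
Lemma argmin_normal p q (M : 'M[R]_(p, q)) (c : 'cV[R]_p) (y : 'cV[R]_q) j :
    is_argmin (fun z => enorm (c - M *m z)) y ->
  dot (c - M *m y) (col j M) = 0.
Proof.
move=> ymin; apply: dot_eq0_of_min => a.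
have := ymin (y + a *: delta_mx j 0).
by rewrite mulmxDr -scalemxAr -colE opprD addrA.
Qed.

Hypothesis beta_neq0 : forall j, (j <= k)%N -> beta j.+1 != 0.

(** The residual [t] and [v] satisfy the same first-order recurrence, so they are
    proportional; pairing with [v] fixes the factor. *)
Lemma lsq_residual (v t : nat -> R) (y : 'cV[R]_k) :
    v 0 = (beta 1)^-1 ->
    (forall j, (j < k)%N -> alpha j.+1 * v j + beta j.+2 * v j.+1 = 0) ->
    is_argmin (fun z : 'cV[R]_k =>
      enorm (beta 1 *: unit_vec R (k + 1) 1 - Lplus_mx k alpha beta *m z)) y ->
    beta 1 *: unit_vec R (k + 1) 1 - Lplus_mx k alpha beta *m y =
      \col_(i < k + 1) t i ->
  forall l, (l <= k)%N -> t l = (\sum_(i < k.+1) v i ^+ 2)^-1 * v l.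
Proof.
move=> v0 v_rec ymin def_t.
have t_rec j : (j < k)%N -> alpha j.+1 * t j + beta j.+2 * t j.+1 = 0.
  move=> jk; have := argmin_normal (Ordinal jk) ymin.
  by rewrite def_t dot_col_Lplus.
have b1 := beta_neq0 (leq0n k).
have tE l : (l <= k)%N -> t l = beta 1 * t 0 * v l.
  elim: l => [_|l IHl lk]; first by rewrite v0 mulrAC divff // mul1r.
  apply: (mulfI (beta_neq0 lk)); apply: (addrI (alpha l.+1 * t l)).
  rewrite t_rec // IHl ?(ltnW lk) // !(mulrCA _ (beta 1 * t 0)) -mulrDr.
  by rewrite v_rec // mulr0.
(* Only the term beta_1 e_1 of [t] contributes, [v] being orthogonal to the range
   of L_(k+). *)
have dot_vt : dot (\col_(i < k + 1) v i) (\col_(i < k + 1) t i) = 1.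
  rewrite -def_t dotBr dotZr dot_mulmx [X in _ - X]big1 => [|j _].
    rewrite subr0 dotE; under eq_bigr do rewrite !mxE eqSS.
    by rewrite sum_ord_delta ?addn1 // v0 divff.
  by rewrite dot_col_Lplus v_rec // mulr0.
have c_sum : beta 1 * t 0 * \sum_(i < k.+1) v i ^+ 2 = 1.
  rewrite -[RHS]dot_vt dotE addn1 mulr_sumr; apply: eq_bigr => i _.
  by rewrite !mxE (tE i (leq_ord i)) [RHS]mulrCA expr2.
move=> l lk; rewrite (tE l lk); congr (_ * _).
have sum0 : \sum_(i < k.+1) v i ^+ 2 != 0.
  by apply: contra_eq_neq c_sum => ->; rewrite mulr0 eq_sym oner_eq0.
by apply: (mulIf sum0); rewrite c_sum mulVf.
Qed.

End ProjectedProblem.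

(** * The residual of LSQR *)

Lemma gk_mulmx_W (R : rcfType) (m n k : nat) (A : 'M[R]_(m.+1, n))
    (b : 'cV[R]_m.+1) (alpha beta : nat -> R)
    (w : nat -> 'cV[R]_n) (s : nat -> 'cV[R]_m.+1) :
  golub_kahan A b k alpha beta w s ->
  A *m W_mx k w = W_mx (k + 1) s *m Lplus_mx k alpha beta.
Proof.
move=> gk; apply/matrixP => i j; rewrite [RHS]mxE.
under [RHS]eq_bigr do rewrite [W_mx _ _ _ _]mxE.
rewrite (sum_Lplus_mx alpha beta (fun l => s l.+1 i 0)).
have /colP/(_ i) := gk_mulA gk (ltn_ord j : 0 < j.+1 <= k)%N.
by rewrite !mxE => <-; apply: eq_bigr => l _; rewrite !mxE.
Qed.

Theorem proposition2 (R : rcfType) (m n k : nat)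
    (A : 'M[R]_(m.+1, n)) (b : 'cV[R]_m.+1)
    (alpha beta : nat -> R) (w : nat -> 'cV[R]_n) (s : nat -> 'cV[R]_m.+1)
    (phi : nat -> {poly R})
    (y : 'cV[R]_k) (x : 'cV[R]_n) (r : 'cV[R]_m.+1) :
  b != 0 ->
  (1 <= k)%N ->
  golub_kahan A b k alpha beta w s ->
  (forall l, (1 <= l <= k)%N -> 0 < alpha l /\ 0 < beta l.+1) ->
  lanczos_polys A b k s phi ->
  is_argmin (fun z : 'cV[R]_k =>
    enorm (beta 1%N *: unit_vec R (k + 1) 1 - Lplus_mx k alpha beta *m z)) y ->
  x = W_mx k w *m y ->
  r = b - A *m x ->
  r = (\sum_(0 <= l < k.+1) (phi l).[0] ^+ 2)^-1 *:
        (\sum_(0 <= l < k.+1) (phi l).[0] *: s l.+1)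
  /\ enorm r = (Num.sqrt (\sum_(0 <= l < k.+1) (phi l).[0] ^+ 2))^-1.
Proof.
move=> b0 _ gk pos phiP ymin def_x def_r.
have beta0 := beta_neq0 b0 gk pos.
pose v l := (lanczos_rec alpha beta l).1.[0].
have v_rec j : (j < k)%N -> alpha j.+1 * v j + beta j.+2 * v j.+1 = 0.
  exact: lanczos_rec_horner0 b0 gk pos j.
have v0 : v 0 = (beta 1)^-1 by rewrite /v /= hornerC.
have phi0 l : (l < k.+1)%N -> (phi l).[0] = v l.
  by move=> lk; rewrite (lanczos_polys_unique b0 gk pos phiP).
have [t def_t] := col_of_nat
  (beta 1 *: unit_vec R (k + 1) 1 - Lplus_mx k alpha beta *m y).
have tE := lsq_residual beta0 v0 v_rec ymin def_t.
have def_b : b = W_mx (k + 1) s *m (beta 1 *: unit_vec R (k + 1) 1).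
  rewrite -scalemxAr /unit_vec (W_mx_mul _ s (fun i => (i.+1 == 1%N)%:R)).
  rewrite addn1 big_ord_recl /= big1 => [|i _]; last by rewrite scale0r.
  by rewrite addr0 scale1r (gk_s1 gk) scalerA divff ?beta0 // scale1r.
set S := \sum_(0 <= l < k.+1) (phi l).[0] ^+ 2.
have SE : S = \sum_(l < k.+1) v l ^+ 2.
  by rewrite /S big_mkord; apply: eq_bigr => l _; rewrite phi0.
have rE : r = S^-1 *: \sum_(0 <= l < k.+1) (phi l).[0] *: s l.+1.
  rewrite def_r def_x mulmxA (gk_mulmx_W gk) -mulmxA {1}def_b -mulmxBr def_t.
  rewrite W_mx_mul addn1 big_mkord scaler_sumr; apply: eq_bigr => l _.
  by rewrite (tE l (leq_ord l)) scalerA phi0 // SE.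
split=> //.
have S_ge0 : 0 <= S by apply: sumr_ge0 => l _; exact: sqr_ge0.
have S_neq0 : S != 0.
  rewrite SE psumr_neq0 => [|l _]; last exact: sqr_ge0.
  apply/hasP; exists ord0; rewrite ?mem_index_enum //= v0.
  by rewrite exprn_even_gt0 //= invr_eq0 beta0.
have [so _] := golub_kahan_orthonormal b0 gk pos (leqnn k).
rewrite enormE rE dotZr dotC dotZr big_mkord.
rewrite (dot_orthonormal_comb (fun l => (phi l).[0]) so).
rewrite -(big_mkord xpredT (fun l => (phi l).[0] ^+ 2)) -/S.
by rewrite mulVf // mulr1 sqrtrV.
Qed.
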